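(* Let $r\ge1$, let $a_1,\dots,a_r$ be positive integers, and let $$\lambda=\big((a_1+\cdots+a_r)^{a_1},(a_1+\cdots+a_{r-1})^{a_2},\ldots,(a_1)^{a_r}\big).$$ Let $G^{\lambda}$ be the Cauchy transform of the distribution $F^{\lambda}$. Then there exists a bivariate polynomial $L^{\lambda}(G,z)\in\mathbb{C}[G,z]$, of degree $r+1$ in $G$ and degree $r$ in $z$, such that $$L^{\lambda}(G^{\lambda}(z),z)=0$$ for all $z\in\mathbb{C}\setminus\mathbb{R}$.
   Context: The notation $(b_1^{m_1},\dots,b_r^{m_r})$ denotes the partition with $m_i$ parts equal to $b_i$ for each $i$. A partition $\lambda$ with $\ell$ positive parts is identified with its Young diagram $\{(i,j)\in\mathbb{Z}^2:1\le i\le\ell,\ 1\le j\le\lambda_i\}$. The partition $\lambda$ of the claim is self-conjugate (its diagram is invariant under $(i,j)\mapsto(j,i)$) and has length $\ell=a_1+\cdots+a_r$. A plane tree is a rooted tree in which the children of every vertex are linearly ordered. A $\lambda$-plane tree is a pair $(T,c)$, where $T$ is a plane tree with vertex set $V$ and edge set $E$ and $c:V\to\{1,\dots,\ell\}$ satisfies $(c(u),c(v))\in\lambda$ whenever $\{u,v\}\in E$. $C_k^{\lambda}$ is the number of $\lambda$-plane trees on $k+1$ vertices (up to isomorphism preserving root, order of children, and labels). $F^{\lambda}$ is the (unique) probability distribution on $[0,\infty)$ with moments $\int_0^\infty x^k\,\mathrm{d}F^{\lambda}(x)=C_k^{\lambda}/\ell^{k+1}$ for $k\ge0$. It has compact support,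 and it is the almost sure limiting spectral distribution of $\frac{1}{N\ell}X_NX_N^*$ as $N\to\infty$, where $X_N$ is the $(N\ell)\times(N\ell)$ matrix with i.i.d. centred unit-variance complex entries at the positions of the dilated diagram $N\lambda$ (each box of $\lambda$ replaced by an $N\times N$ grid of boxes) and zeros elsewhere. The Cauchy transform of a probability distribution $F$ is $G(z)=\int\frac{1}{z-x}\,\mathrm{d}F(x)$, $z\in\mathbb{C}\setminus\mathbb{R}$. *)

(* Defs.v *)
From HB Require Import structures.
From mathcomp Require Import all_boot all_order all_algebra.
From mathcomp Require Import finmap.
From mathcomp Require Import all_classical all_reals all_analysis.
From mathcomp Require Import complex polyXY.

Set Implicit Arguments.
Unset Strict Implicit.
Unset Printing Implicit Defensive.

Import Order.TTheory GRing.Theory Num.Theory.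

Local Open Scope classical_set_scope.
Local Open Scope ring_scope.
Local Open Scope complex_scope.

(* The partition (b_1^{m_1}, ..., b_r^{m_r}), as the sequence of its parts. *)
Definition part_of_mult (bm : seq (nat * nat)) : seq nat :=
  flatten [seq nseq p.2 p.1 | p <- bm].

(* ((a_1 + ... + a_r)^{a_1}, (a_1 + ... + a_{r-1})^{a_2}, ..., (a_1)^{a_r});
   nth counts from 0, so i ranges over 0, ..., r - 1. *)
Definition staircase (a : seq nat) : seq nat :=
  part_of_mult
    [seq (sumn (take (size a - i) a), nth 0%N a i) | i <- iota 0 (size a)].

(* Boxes (i, j) are numbered from 1. *)
Definition young_diagram (lambda : seq nat) : pred (nat * nat) :=
  fun ij => [&& (1 <= ij.1 <= size lambda)%N
              & (1 <= ij.2 <= nth 0%N lambda ij.1.-1)%N].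

(* A pair (T, c) of a plane tree T and a labelling c of its vertices by L, up
   to isomorphism: each vertex carries its label and its list of children. *)
Inductive ltree (L : Type) : Type := LNode of L & seq (ltree L).

Definition root_label (L : Type) (t : ltree L) : L := let: LNode x _ := t in x.

Fixpoint nb_vertices (L : Type) (t : ltree L) : nat :=
  let: LNode _ s := t in (sumn [seq nb_vertices u | u <- s]).+1.

Fixpoint edges_labels (L : Type) (t : ltree L) : seq (L * L) :=
  let: LNode x s := t in
  [seq (x, root_label u) | u <- s] ++ flatten [seq edges_labels u | u <- s].

Fixpoint ltree_encode (L : Type) (t : ltree L) : GenTree.tree L :=
  let: LNode x s := t in
  GenTree.Node 0 (GenTree.Leaf x :: [seq ltree_encode u | u <- s]).

Fixpoint ltree_decode (L : Type) (g : GenTree.tree L) : option (ltree L) :=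
  if g is GenTree.Node _ (GenTree.Leaf x :: s) then
    Some (LNode x (pmap (@ltree_decode L) s))
  else None.

Lemma ltree_encodeK (L : Type) : pcancel (@ltree_encode L) (@ltree_decode L).
Proof.
rewrite /pcancel; fix IH 1 => -[x s] /=; congr (Some (LNode _ _)).
by elim: s => //= u s IHs; rewrite IH /= IHs.
Qed.

HB.instance Definition _ (L : eqType) :=
  Equality.copy (ltree L) (pcan_type (@ltree_encodeK L)).
HB.instance Definition _ (L : choiceType) :=
  Choice.copy (ltree L) (pcan_type (@ltree_encodeK L)).

(* The element k of 'I_(size lambda) encodes the label k + 1. Edges are
   unordered, hence the two conditions; they agree if lambda is
   self-conjugate. *)
Definition is_lambda_plane_tree (lambda : seq nat)
    (t : ltree 'I_(size lambda)) : bool :=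
  let adj (i j : 'I_(size lambda)) := young_diagram lambda (i.+1, j.+1) in
  all (fun e => adj e.1 e.2 && adj e.2 e.1) (edges_labels t).

Definition lambda_plane_trees (lambda : seq nat) (k : nat) :
    set (ltree 'I_(size lambda)) :=
  [set t | is_lambda_plane_tree t /\ nb_vertices t = k.+1].
Arguments lambda_plane_trees : clear implicits.

Fixpoint words_upto (T : Type) (m : nat) (A : seq T) : seq (seq T) :=
  [::] :: (if m is m'.+1 then [seq x :: w | x <- A, w <- words_upto m' A]
           else [::]).

Fixpoint ltrees_upto (L : finType) (n : nat) : seq (ltree L) :=
  if n is n'.+1 then
    [seq LNode x s | x <- enum L, s <- words_upto n' (ltrees_upto L n')]
  else [::].

Lemma mem_words_upto (T : eqType) (m : nat) (A w : seq T) :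
  (size w <= m)%N -> {subset w <= A} -> w \in words_upto m A.
Proof.
elim: m w => [|m IHm] [|x w] //= wm wA; rewrite inE /=.
apply/allpairsP; exists (x, w); split=> //=; first by apply: wA; rewrite mem_head.
by apply: IHm => // y yw; apply: wA; rewrite inE yw orbT.
Qed.

Lemma mem_ltrees_upto (L : finType) (n : nat) (t : ltree L) :
  (nb_vertices t <= n)%N -> t \in ltrees_upto L n.
Proof.
elim: n t => [|n IHn] [x s] //=; rewrite ltnS => sn.
apply/allpairsP; exists (x, s); split=> //=; first by rewrite mem_enum.
apply: mem_words_upto => [|u us].
  apply: leq_trans sn; elim: s => //= -[y v] s IHs /=.
  by rewrite addSn ltnS (leq_trans IHs) ?leq_addl.
apply: IHn; apply: leq_trans sn; elim: s us => //= v s IHs.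
rewrite inE => /predU1P[->|/IHs us]; first exact: leq_addr.
by rewrite (leq_trans us) ?leq_addl.
Qed.

Lemma finite_lambda_plane_trees (lambda : seq nat) (k : nat) :
  finite_set (lambda_plane_trees lambda k).
Proof.
apply: (@sub_finite_set _ _ [set` ltrees_upto 'I_(size lambda) k.+1]).
  by move=> t [_ tk]; apply: (@mem_ltrees_upto _ k.+1); rewrite tk.
exact: finite_seq.
Qed.

(* C_k^lambda; the set counted is finite by finite_lambda_plane_trees. *)
Definition lambda_tree_count (lambda : seq nat) (k : nat) : nat :=
  #|` fset_set (lambda_plane_trees lambda k)|.

(* F is the distribution F^lambda; the moment conditions determine it. *)
Definition is_F_lambda (R : realType) (lambda : seq nat)
    (F : probability (measurableTypeR R) R) : Prop :=
  F `[0%R, +oo[%classic = 1%E /\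
  forall k : nat,
    (\int[F]_(x in `[0%R, +oo[) (x ^+ k)%:E)%E =
    ((lambda_tree_count lambda k)%:R / (size lambda)%:R ^+ k.+1)%:E.

Definition cauchy_transform (R : realType)
    (F : probability (measurableTypeR R) R) (z : R[i]) : R[i] :=
  (\int[F]_x complex.Re (1 / (z - x%:C)))%R +i*
  (\int[F]_x complex.Im (1 / (z - x%:C)))%R.

(* Main.v *)
Require Import Defs.
From mathcomp Require Import all_boot all_order all_algebra.
From mathcomp Require Import finmap.
From mathcomp Require Import all_classical all_reals all_analysis.
From mathcomp Require Import measurable_realfun complex polyXY.
From mathcomp Require Import zify ring lra.
Import Order.TTheory GRing.Theory Num.Theory.
Import numFieldNormedType.Exports.
Set Implicit Arguments.
Unset Strict Implicit.
Unset Printing Implicit Defensive.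
Local Open Scope classical_set_scope.
Local Open Scope ring_scope.
Local Open Scope complex_scope.

(* Let [F_q(x)] be the generating series of the forests that can hang below a
   vertex labelled [q], [A_k = a_1 + ... + a_k], [l = A_r], and
   [s_k = 1 - x * sum_(q <= A_k) F_q], so that [s_0 = 1] and [s_r = 1 - G] where
   [x = 1 / (l z)]. Labels of block [k + 1] are adjacent to the labels at most
   [A_(r-k)], hence [F_q s_(r-k) = 1] there and
   [(s_k - s_(k+1)) s_(r-k) = a_(k+1) x]. By induction, [s_i s_j] is
   [s_r + (l - A_i - A_j) x] when [i + j] is [r] or [r + 1]. The products
   [s_r * prod_(k < r) s_k s_(r-k)] and [prod_(k < r) s_(k+1) s_(r-k)] coincide,
   which is a polynomial equation between [G] and [x]. It is an identity of
   power series, valid for [|Im z| > 4] where the series converge. The disc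
   centred at [w = z + 4 i sgn (Im z)] of radius [|Im w|] contains [z], and
   there [G] is the sum of its Taylor series at [w]; the equation holds near
   [w], hence on the disc. *)

(** * Power series as sequences of polynomials *)

Section PolyNorm.
Variable K : numFieldType.
Implicit Types (p q : {poly K}) (L : {poly {poly K}}) (rho s u v : K).

(** This weighted l1 norm is submultiplicative and dominates [|p|] on the disc of radius [rho], so a
    bound uniform over all truncations plays the part of convergence of the series. *)
Definition poly_norm rho p : K := \sum_(i < size p) `|p`_i| * rho ^+ i.

Lemma poly_norm_wide n rho p :
  (size p <= n)%N -> poly_norm rho p = \sum_(i < n) `|p`_i| * rho ^+ i.
Proof.
move=> pn; rewrite /poly_norm (big_ord_widen n (fun i => `|p`_i| * rho ^+ i)) //.
rewrite big_mkcond; apply: eq_bigr => i _; case: ltnP => // ip.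
by rewrite nth_default // normr0 mul0r.
Qed.

Lemma poly_norm_ge0 rho p : 0 <= rho -> 0 <= poly_norm rho p.
Proof. by move=> r0; apply: sumr_ge0 => i _; rewrite mulr_ge0 ?exprn_ge0. Qed.

Lemma poly_normD rho p q :
  0 <= rho -> poly_norm rho (p + q) <= poly_norm rho p + poly_norm rho q.
Proof.
move=> r0; set n := maxn (size p) (size q).
rewrite !(@poly_norm_wide n) ?leq_maxl ?leq_maxr ?size_polyD // -big_split.
apply: ler_sum => i _ /=; rewrite coefD -mulrDl ler_wpM2r ?exprn_ge0 //.
exact: ler_normD.
Qed.

Lemma poly_normXD rho p c :
  poly_norm rho (p * 'X + c%:P) = poly_norm rho p * rho + `|c|.
Proof.
rewrite (@poly_norm_wide (size p).+1); last first.
  rewrite (leq_trans (size_polyD _ _)) // geq_max (leq_trans (size_polyMleq _ _)).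
    by rewrite (leq_trans (size_polyC_leq1 _)).
  by rewrite size_polyX addn2.
rewrite big_ord_recl coefD coefMX coefC /= add0r mulr1 addrC; congr (_ + _).
rewrite mulr_suml; apply: eq_bigr => i _.
by rewrite /bump /= add1n coefD coefMX coefC /= addr0 exprSr mulrA.
Qed.

Lemma poly_norm0 rho : poly_norm rho 0 = 0.
Proof. by rewrite /poly_norm size_poly0 big_ord0. Qed.

Lemma poly_normMX rho p : poly_norm rho (p * 'X) = poly_norm rho p * rho.
Proof. by have := poly_normXD rho p 0; rewrite normr0 !addr0. Qed.

Lemma poly_normZ rho c p : poly_norm rho (c *: p) = `|c| * poly_norm rho p.
Proof.
rewrite [LHS](@poly_norm_wide (size p)) ?size_scale_leq // mulr_sumr.
by apply: eq_bigr => i _; rewrite coefZ normrM mulrA.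
Qed.

(** Induction along the Horner scheme of [p]: each step is a shift by ['X], which scales the norm by
    exactly [rho], plus a scalar multiple of [q]. *)
Lemma poly_normM rho p q :
  0 <= rho -> poly_norm rho (p * q) <= poly_norm rho p * poly_norm rho q.
Proof.
move=> r0; elim/poly_ind: p => [|p c IHp]; first by rewrite !mul0r poly_norm0 mul0r.
rewrite poly_normXD mulrDl -mulrA (mulrC 'X) mulrA.
apply: le_trans (poly_normD _ _ r0) _.
rewrite poly_normMX mul_polyC poly_normZ mulrDl lerD2r (mulrAC _ rho).
by rewrite ler_wpM2r.
Qed.

Lemma poly_normX rho p n : poly_norm rho (p * 'X^n) = poly_norm rho p * rho ^+ n.
Proof.
elim: n => [|n IHn]; first by rewrite !mulr1.
by rewrite exprSr mulrA poly_normMX IHn exprSr mulrA.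
Qed.

Lemma poly_norm_sum rho (I : Type) (r : seq I) (P : pred I) (f : I -> {poly K}) :
  0 <= rho ->
  poly_norm rho (\sum_(i <- r | P i) f i) <= \sum_(i <- r | P i) poly_norm rho (f i).
Proof.
move=> r0; elim/big_rec2: _ => [|i p q _ IH]; first by rewrite poly_norm0.
by rewrite (le_trans (poly_normD _ _ r0)) // lerD2l.
Qed.

Lemma norm_horner_le rho p s : `|s| <= rho -> `|p.[s]| <= poly_norm rho p.
Proof.
move=> sr; rewrite horner_coef (le_trans (ler_norm_sum _ _ _)) //.
apply: ler_sum => i _; rewrite normrM normrX ler_wpM2l //.
by rewrite lerXn2r // nnegrE (le_trans (normr_ge0 s)).
Qed.

(** The point is uniformity: one [C] serves every [p] in the ball, hence all truncations of a series
    at once. *)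
Lemma poly_norm_hornerP rho L M :
  0 <= rho -> 0 <= M ->
  exists2 C, 0 <= C & forall p, poly_norm rho p <= M -> poly_norm rho L.[p] <= C.
Proof.
move=> r0 M0; elim/poly_ind: L => [|L c [C C0 IH]].
  by exists 0 => // p _; rewrite horner0 poly_norm0.
exists (C * M + poly_norm rho c) => [|p pM].
  by rewrite addr_ge0 ?mulr_ge0 ?poly_norm_ge0.
rewrite !hornerE (le_trans (poly_normD _ _ r0)) // lerD2r.
rewrite (le_trans (poly_normM _ _ r0)) // ler_pM ?poly_norm_ge0 //.
exact: IH.
Qed.

Lemma horner2_lipschitz L rho M :
  0 <= rho -> 0 <= M ->
  exists2 C, 0 <= C & forall s u v, `|s| <= rho -> `|u| <= M -> `|v| <= M ->
    `|L.[u, s] - L.[v, s]| <= C * `|u - v|.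
Proof.
move=> r0 M0.
(* The induction also carries a bound [D] on the values, since the difference of two products [L u]
   and [L v] involves both a difference and a value of [L]. *)
suff [C C0 [D D0 CD]] : exists2 C, 0 <= C & exists2 D, 0 <= D &
    forall s u v, `|s| <= rho -> `|u| <= M -> `|v| <= M ->
    `|L.[v, s]| <= D /\ `|L.[u, s] - L.[v, s]| <= C * `|u - v|.
  by exists C => // s u v sr uM vM; have [] := CD s u v sr uM vM.
elim/poly_ind: L => [|L c [C C0 [D D0 IH]]].
  exists 0 => //; exists 0 => // s u v _ _ _.
  by rewrite !horner0 subrr normr0 mul0r.
exists (C * M + D); first by rewrite addr_ge0 ?mulr_ge0.
exists (D * M + poly_norm rho c) => [|s u v sr uM vM].
  by rewrite addr_ge0 ?mulr_ge0 ?poly_norm_ge0.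
have [vD uvC] := IH s u v sr uM vM; rewrite !hornerE; split.
  rewrite (le_trans (ler_normD _ _)) // lerD ?norm_horner_le // normrM.
  by rewrite ler_pM.
rewrite opprD addrACA subrr addr0.
have -> : L.[u, s] * u - L.[v, s] * v =
    (L.[u, s] - L.[v, s]) * u + L.[v, s] * (u - v).
  by rewrite mulrBl mulrBr addrA subrK.
rewrite (le_trans (ler_normD _ _)) // !normrM mulrDl lerD //; last first.
  by rewrite ler_wpM2r.
by rewrite mulrAC ler_pM.
Qed.

(** A Schwarz lemma: multiplication by ['X^n] scales the norm by exactly [rho ^+ n], so the cofactor
    of ['X^n] has norm [poly_norm rho p / rho ^+ n]. *)
Lemma norm_horner_dvdXn rho s n p :
  0 < rho -> `|s| <= rho -> 'X^n %| p ->
  `|p.[s]| <= poly_norm rho p * (`|s| / rho) ^+ n.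
Proof.
move=> r0 sr /dvdpP[q ->]; rewrite hornerM hornerXn normrM normrX poly_normX.
rewrite expr_div_n mulrACA mulfV ?expf_neq0 ?gt_eqF // mulr1 mulrC.
by rewrite mulrC ler_wpM2r ?exprn_ge0 // norm_horner_le.
Qed.

Lemma horner2_horner L p s : L.[p].[s] = L.[p.[s], s].
Proof.
by elim/poly_ind: L => [|L c IH]; [rewrite !horner0 | rewrite !hornerE IH].
Qed.

(* The values [L(P_n(s), s)] tend to [0] because their power series start at
   order [n] while their norms on a larger disc stay bounded. *)
Lemma horner2_limit_le L (P : nat -> {poly K}) rho M s g A t :
  0 < rho -> 0 <= M -> 0 <= A -> `|s| <= t * rho -> t <= 1 ->
  (forall n, poly_norm rho (P n) <= M) ->
  (forall n, 'X^n %| L.[P n]) ->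
  (forall n, `|(P n).[s] - g| <= A * t ^+ n) ->
  exists2 C, 0 <= C & forall n, `|L.[g, s]| <= C * t ^+ n.
Proof.
move=> r0 M0 A0 st t1 PM LP Pg.
have t0 : 0 <= t by rewrite -(pmulr_lge0 _ r0) (le_trans _ st).
have sr : `|s| <= rho by rewrite (le_trans st) // ler_piMl // ltW.
have [C C0 HC] := poly_norm_hornerP L (ltW r0) M0.
have [D D0 HD] := horner2_lipschitz L (ltW r0) (addr_ge0 M0 A0).
exists (C + D * A) => [|n]; first by rewrite addr_ge0 ?mulr_ge0.
have PnM m : `|(P m).[s]| <= M by rewrite (le_trans (norm_horner_le _ sr)).
have gM : `|g| <= M + A.
  rewrite -[g](subrK (P 0%N).[s]) addrC (le_trans (ler_normD _ _)) // lerD //.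
  by have := Pg 0%N; rewrite mulr1 distrC.
have -> : L.[g, s] = L.[P n].[s] - (L.[(P n).[s], s] - L.[g, s]).
  by rewrite (horner2_horner _ (P n)) opprB addrCA subrr addr0.
rewrite (le_trans (ler_normB _ _)) // mulrDl lerD //.
  rewrite (le_trans (norm_horner_dvdXn r0 sr (LP n))) // ler_pM ?HC //.
  - exact/poly_norm_ge0/ltW.
  - by rewrite exprn_ge0 // divr_ge0 // ltW.
  - by rewrite lerXn2r ?nnegrE ?divr_ge0 ?(ltW r0) // ler_pdivrMr.
rewrite (le_trans (HD _ _ _ sr _ gM)) ?(le_trans (PnM n)) ?lerDl //.
by rewrite -mulrA ler_wpM2l.
Qed.

Lemma eq0_norm_le_unit (C c : K) :
  0 <= C -> (forall t, 0 < t <= 1 -> `|c| <= C * t) -> c = 0.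
Proof.
move=> C0 H; apply/eqP/contraT => c0.
have cp : 0 < `|c| by rewrite normr_gt0.
have Cc : 0 < C + `|c| by rewrite ltr_wpDl.
(* At this [t] the bound becomes [|c| (C + |c|) <= C |c|], which contradicts [|c| > 0]. *)
have := H (`|c| / (C + `|c|)).
rewrite divr_gt0 //= ler_pdivrMr // mul1r lerDr C0 => /(_ isT).
rewrite mulrA ler_pdivlMr // mulrDr (mulrC C) gerDl.
by rewrite lt_geF // mulr_gt0.
Qed.

(** Induction on [n]: the constant term is [O(t)], hence zero, and dividing by [t] lowers the
    exponent. Over the complex numbers [0 < t <= 1] confines [t] to a real segment, which is
    enough. *)
Lemma dvdXn_norm_le (p : {poly K}) (C : K) n :
  0 <= C -> (forall t, 0 < t <= 1 -> `|p.[t]| <= C * t ^+ n) -> 'X^n %| p.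
Proof.
elim: n p C => [|n IHn] p C C0 pC; first by rewrite expr0 dvd1p.
have [p' [c def_p]] : exists p', exists c, p = p' * 'X + c%:P.
  by elim/poly_ind: p {pC} => [|p c _]; [exists 0, 0; rewrite mul0r add0r|exists p, c].
have t_le1 t : 0 < t <= 1 -> t ^+ n.+1 <= t.
  by case/andP=> /ltW t0 t1; rewrite exprS ler_piMr // exprn_ile1.
have c0 : c = 0.
  apply: (@eq0_norm_le_unit (C + poly_norm 1 p')) => [|t t01].
    by rewrite addr_ge0 ?poly_norm_ge0.
  have [t0 t1] := andP t01.
  have -> : c = p.[t] - p'.[t] * t by rewrite def_p !hornerE addrC addKr.
  rewrite (le_trans (ler_normB _ _)) // mulrDl lerD //.
    by rewrite (le_trans (pC t t01)) // ler_wpM2l // t_le1.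
  by rewrite normrM (gtr0_norm t0) ler_wpM2r ?(ltW t0) ?norm_horner_le // gtr0_norm.
rewrite def_p c0 addr0 exprSr dvdp_mul //; apply: (IHn _ C) => // t t01.
have [t0 t1] := andP t01; have := pC t t01.
rewrite def_p c0 addr0 hornerMX normrM (gtr0_norm t0) exprSr mulrA.
by rewrite ler_pM2r.
Qed.

End PolyNorm.

(** * Congruence modulo [X^n] *)

Section CongruenceModXn.
Variables (K : fieldType) (n : nat).
Implicit Types p q : {poly K}.

Lemma dvdXnP p : reflect (forall i, (i < n)%N -> p`_i = 0) ('X^n %| p).
Proof.
apply: (iffP idP) => [/dvdpP[q ->] i lt_in|p0]; first by rewrite coefMXn lt_in.
rewrite -(poly_take_drop n p) dvdp_add ?dvdp_mull //.
suff -> : take_poly n p = 0 by rewrite dvdp0.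
by apply/polyP => i; rewrite coef_take_poly coef0; case: ltnP => // /p0.
Qed.

(** Identities between power series are stated as congruences between their truncations at order
    [n]. *)
Definition eqmodXn p q := 'X^n %| p - q.

Lemma eqmodXn_refl p : eqmodXn p p.
Proof. by rewrite /eqmodXn subrr dvdp0. Qed.

Lemma eqmodXn_sym p q : eqmodXn p q -> eqmodXn q p.
Proof. by rewrite /eqmodXn -opprB dvdpNr. Qed.

Lemma eqmodXn_trans q p s : eqmodXn p q -> eqmodXn q s -> eqmodXn p s.
Proof. by rewrite /eqmodXn => pq qs; rewrite -(subrKA q) dvdp_add. Qed.

Lemma eqmodXnD p1 q1 p2 q2 :
  eqmodXn p1 q1 -> eqmodXn p2 q2 -> eqmodXn (p1 + p2) (q1 + q2).
Proof. by rewrite /eqmodXn => h1 h2; rewrite opprD addrACA dvdp_add. Qed.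

Lemma eqmodXnM p1 q1 p2 q2 :
  eqmodXn p1 q1 -> eqmodXn p2 q2 -> eqmodXn (p1 * p2) (q1 * q2).
Proof.
rewrite /eqmodXn => h1 h2.
have -> : p1 * p2 - q1 * q2 = (p1 - q1) * p2 + q1 * (p2 - q2) by ring.
by apply: dvdp_add; [exact: dvdp_mulr | exact: dvdp_mull].
Qed.

Lemma eqmodXn_sum (I : Type) (r : seq I) (P : pred I) (f g : I -> {poly K}) :
  (forall i, P i -> eqmodXn (f i) (g i)) ->
  eqmodXn (\sum_(i <- r | P i) f i) (\sum_(i <- r | P i) g i).
Proof.
move=> fg; elim/big_rec2: _ => [|i p q Pi]; first exact: eqmodXn_refl.
by apply: eqmodXnD; exact: fg.
Qed.

Lemma eqmodXn_prod (I : Type) (r : seq I) (P : pred I) (f g : I -> {poly K}) :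
  (forall i, P i -> eqmodXn (f i) (g i)) ->
  eqmodXn (\prod_(i <- r | P i) f i) (\prod_(i <- r | P i) g i).
Proof.
move=> fg; elim/big_rec2: _ => [|i p q Pi]; first exact: eqmodXn_refl.
by apply: eqmodXnM; exact: fg.
Qed.

End CongruenceModXn.

(** * The algebraic equation of the staircase *)

Section StaircaseEquation.
Variables (K : fieldType) (A : nat -> nat) (r : nat).

(** The coefficients [l - A_i - A_j] of [x] in [s_i s_j], with [l = A_r]: here [(i, j)] is
    [(k, r - k)], and for [stair_den] it is [(k + 1, r - k)]. *)
Definition stair_num (k : nat) : K := (A r)%:R - (A k)%:R - (A (r - k))%:R.
Definition stair_den (k : nat) : K := (A r)%:R - (A k.+1)%:R - (A (r - k))%:R.

(* The equation satisfied by [G] as a function of [x = 1 / (l z)]. *)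
Definition stair_poly : {poly {poly K}} :=
  (1 - 'X) * \prod_(k < r) (1 - 'X + (stair_num k *: 'X)%:P)
  - \prod_(k < r) (1 - 'X + (stair_den k *: 'X)%:P).

Variables (n : nat) (s : nat -> {poly K}).
Hypotheses (A0 : A 0 = 0%N) (s0 : s 0 = 1).
Hypothesis sP : forall k, (k < r)%N ->
  eqmodXn n ((s k - s k.+1) * s (r - k)%N) (((A k.+1)%:R - (A k)%:R) *: 'X).

(** A walk on index pairs from [(0, r)], where [s_0 = 1]. Subtracting [sP] at [k] leads from
    [(k, r - k)] to [(k + 1, r - k)]; adding [sP] at [r - k - 1] leads on to
    [(k + 1, r - k - 1)]. *)
Lemma stair_mul k : (k <= r)%N ->
  eqmodXn n (s k * s (r - k)%N) (s r + stair_num k *: 'X) /\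
  ((k < r)%N -> eqmodXn n (s k.+1 * s (r - k)%N) (s r + stair_den k *: 'X)).
Proof.
have half j : (j < r)%N -> eqmodXn n (s j * s (r - j)%N) (s r + stair_num j *: 'X) ->
    eqmodXn n (s j.+1 * s (r - j)%N) (s r + stair_den j *: 'X).
  move=> jr IH; have := eqmodXnD IH (eqmodXnM (eqmodXn_refl n (-1)) (sP jr)).
  rewrite /eqmodXn; congr (_ %| _ - _); first by ring.
  by rewrite /stair_num /stair_den -!mul_polyC !raddfB /=; ring.
elim: k => [|k IHk] kr.
  have h : eqmodXn n (s 0 * s (r - 0)%N) (s r + stair_num 0 *: 'X).
    by rewrite s0 mul1r subn0 /stair_num A0 subn0 subr0 subrr scale0r addr0 eqmodXn_refl.
  by split=> // /half; apply.
have {IHk}[_ /(_ kr) IH] := IHk (ltnW kr).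
have kr' : (r - k.+1 < r)%N by lia.
have h : eqmodXn n (s k.+1 * s (r - k.+1)%N) (s r + stair_num k.+1 *: 'X).
  have := eqmodXnD IH (sP kr').
  have -> : (r - k.+1).+1 = (r - k)%N by lia.
  have -> : (r - (r - k.+1) = k.+1)%N by lia.
  rewrite /eqmodXn; congr (_ %| _ - _); first by ring.
  by rewrite /stair_num /stair_den -!mul_polyC !raddfB /=; ring.
by split=> // kr2; apply: half.
Qed.

(* Both products are congruent to [s_0 s_1^2 ... s_(r-1)^2 s_r] up to
   [s_0 = 1], after reversing the order of half of the factors. *)
Lemma stair_poly_dvd : 'X^n %| stair_poly.[1 - s r].
Proof.
have HE (c : nat -> K) : (\prod_(k < r) (1 - 'X + (c k *: 'X)%:P)).[1 - s r] =
    \prod_(k < r) (s r + c k *: 'X).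
  rewrite horner_prod; apply: eq_bigr => k _.
  by rewrite !hornerE; congr (_ + _); rewrite opprB addrC subrK.
rewrite !hornerE !HE opprB addrCA subrr addr0 -/(eqmodXn _ _ _).
have num : eqmodXn n (s r * \prod_(k < r) (s r + stair_num k *: 'X))
    (s r * \prod_(k < r) (s k * s (r - k)%N)).
  apply: eqmodXnM (eqmodXn_refl _ _) _; apply: eqmodXn_prod => k _.
  by apply: eqmodXn_sym; have [] := stair_mul (ltnW (ltn_ord k)).
apply: eqmodXn_trans num _.
have den : eqmodXn n (\prod_(k < r) (s k.+1 * s (r - k)%N))
     (\prod_(k < r) (s r + stair_den k *: 'X)).
  apply: eqmodXn_prod => k _.
  by have [_ ->] := stair_mul (ltnW (ltn_ord k)).
apply: eqmodXn_trans den.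
have <- : s r * \prod_(k < r) (s k * s (r - k)%N) =
    \prod_(k < r) (s k.+1 * s (r - k)%N); last exact: eqmodXn_refl.
rewrite !big_split /= mulrA; congr (_ * _).
transitivity (\prod_(k < r.+1) s k); first by rewrite big_ord_recr mulrC.
by rewrite big_ord_recl s0 mul1r.
Qed.

End StaircaseEquation.

(** * Labelled trees and the staircase *)

Section Forests.
Variables (T : finType) (e : rel T).

Definition proper_tree (t : ltree T) := all (fun p => e p.1 p.2) (edges_labels t).

Lemma proper_tree_cons i u s :
  proper_tree (LNode i (u :: s)) =
  [&& e i (root_label u), proper_tree u & proper_tree (LNode i s)].
Proof.
by rewrite /proper_tree /= !all_cat; congr (_ && _); rewrite andbCA.
Qed.

Lemma nb_vertices_cons i (u : ltree T) s :
  nb_vertices (LNode i (u :: s)) = (nb_vertices u + nb_vertices (LNode i s))%N.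
Proof. by rewrite /= addnS. Qed.

(* The ordered forests with [n] vertices that can be hung below a root
   labelled [i]. *)
Definition forests (i : T) (n : nat) : seq (seq (ltree T)) :=
  [seq s <- undup [seq (let: LNode _ s := t in s) | t <- ltrees_upto T n.+1]
     | proper_tree (LNode i s) & nb_vertices (LNode i s) == n.+1].

(** [ltrees_upto] lists every tree with at most [n + 1] vertices, so the enumeration misses nothing
    and only the filter decides. *)
Lemma mem_forests i n s :
  (s \in forests i n) =
  proper_tree (LNode i s) && (nb_vertices (LNode i s) == n.+1).
Proof.
rewrite mem_filter andb_idr // => /andP[_ /eqP sn].
rewrite mem_undup; apply/mapP; exists (LNode i s) => //.
by apply: mem_ltrees_upto; rewrite sn.
Qed.

Lemma forests_uniq i n : uniq (forests i n).
Proof. exact/filter_uniq/undup_uniq. Qed.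

Definition nb_forests i n := size (forests i n).

Lemma nb_forests0 i : nb_forests i 0 = 1%N.
Proof.
rewrite /nb_forests; suff /perm_size -> : perm_eq (forests i 0) [:: [::]] by [].
apply: uniq_perm; rewrite ?forests_uniq // => s.
rewrite mem_forests inE; case: s => [|u s] //.
by rewrite nb_vertices_cons; case: u => x w; rewrite /= addnS andbF.
Qed.

(** A nonempty forest splits into its first tree and the rest. The first tree has a root labelled
    [j] and [m] vertices below it, which leaves [n - m] vertices for the other trees. *)
Lemma nb_forestsS i n :
  nb_forests i n.+1 =
  (\sum_(j | e i j) \sum_(m < n.+1) nb_forests j m * nb_forests i (n - m))%N.
Proof.
pose J := [seq (j, m) | j <- enum (e i), m <- iota 0 n.+1].
pose S (p : T * nat) := [seq (v, s) | v <- forests p.1 p.2, s <- forests i (n - p.2)].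
pose W := [seq LNode p.1 q.1 :: q.2 | p <- J, q <- S p].
have Suniq p : uniq (S p).
  by apply: allpairs_uniq; rewrite ?forests_uniq // => -[? ?] [? ?].
have Wuniq : uniq W.
  apply: allpairs_uniq_dep => //.
    by apply: allpairs_uniq; rewrite ?enum_uniq ?iota_uniq // => -[? ?] [? ?].
  (* The label [j] and both forests are read off the result; [m] is recovered as the number of
     vertices of the forest [v]. *)
  move=> p q /allpairsPdep[[j m] [[v s] [_ vsS ->]]].
  move=> /allpairsPdep[[j' m'] [[v' s'] [_ vsS' ->]]] /= [eqj eqv eqs].
  move: vsS vsS'; rewrite eqj eqv eqs => /allpairsP[[v1 s1] /=].
  rewrite mem_forests => -[/andP[_ /eqP vm] _ [ev _]].
  move=> /allpairsP[[v2 s2] /=].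
  rewrite mem_forests => -[/andP[_ /eqP vm'] _ [ev' _]].
  by move: vm vm'; rewrite -ev -ev' /= => -[->] [->].
have -> : nb_forests i n.+1 = size W.
  apply: perm_size; apply: uniq_perm; rewrite ?forests_uniq // => s.
  apply/idP/allpairsPdep => [|[p [q [/allpairsP[[j m] []]]]]].
    rewrite mem_forests; case: s => [|[j v] s]; first by rewrite andbC.
    rewrite proper_tree_cons nb_vertices_cons => /andP[/and3P[/= eij vj si] /eqP nn].
    pose m := sumn [seq nb_vertices u | u <- v].
    have mn : (m <= n)%N by move: nn; rewrite -/m; lia.
    exists (j, m), (v, s); split => //.
      by apply: allpairs_f; rewrite ?mem_enum // mem_iota.
    apply: allpairs_f; rewrite /= mem_forests ?vj ?si /= ?eqxx //.
    by rewrite -/m in nn; apply/eqP; lia.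
  rewrite mem_enum mem_iota add0n ltnS /= => eij mn -> /allpairsP[[v w] /= [vf sf ->]] ->.
  move: vf sf; rewrite !mem_forests => /andP[vp /eqP vn] /andP[sp /eqP sn].
  rewrite proper_tree_cons nb_vertices_cons vp sp vn sn /= andbT.
  by rewrite [e _ _]eij /=; apply/eqP; lia.
rewrite size_allpairs_dep sumnE big_map big_allpairs big_enum.
apply: eq_bigr => j _; rewrite -[iota 0 n.+1]/(index_iota 0 n.+1) big_mkord.
by apply: eq_bigr => m _; rewrite size_allpairs.
Qed.

End Forests.

(** The symmetrised condition is the one in [is_lambda_plane_tree], so that [proper_tree] for this
    relation unfolds to the same test. *)
Definition label_adj lambda : rel 'I_(size lambda) := fun i j =>
  young_diagram lambda (i.+1, j.+1) && young_diagram lambda (j.+1, i.+1).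

(** A tree amounts to its root label and the forest below the root. *)
Lemma lambda_tree_countE (lambda : seq nat) (k : nat) :
  lambda_tree_count lambda k = (\sum_i nb_forests (@label_adj lambda) i k)%N.
Proof.
set e := @label_adj lambda.
pose W := [seq LNode i s | i <- enum 'I_(size lambda), s <- forests e i k].
have Wuniq : uniq W.
  apply: allpairs_uniq_dep => [|i _|]; rewrite ?enum_uniq ?forests_uniq //.
  by move=> [i s] [j t] _ _ /= [-> ->].
have memW t : (t \in W) = is_lambda_plane_tree t && (nb_vertices t == k.+1).
  case: t => i s; apply/allpairsPdep/idP => [[j [w [_ wf [-> ->]]]]|].
    by move: wf; rewrite mem_forests.
  by move=> st; exists i, s; rewrite mem_enum mem_forests.
have -> : lambda_tree_count lambda k = size W.
  rewrite /lambda_tree_count -(undup_id Wuniq) -card_fseq; congr (#|` _|).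
  apply/fsetP => t; rewrite in_fset_set; last exact: finite_lambda_plane_trees.
  rewrite inE memW /=; apply/idP/andP => [|[tl /eqP tn]].
    by rewrite in_setE => -[-> ->].
  by rewrite in_setE.
by rewrite size_allpairs_dep sumnE big_map big_enum.
Qed.

(** * Generating series of forests *)

Section ForestSeries.
Variables (K : numFieldType) (T : finType) (e : rel T).

Definition forest_poly (n : nat) (i : T) : {poly K} :=
  \poly_(m < n) (nb_forests e i m)%:R.

Lemma coef_forest_poly_mul n i m : (m < n)%N ->
  ((\sum_(j | e i j) forest_poly n j) * forest_poly n i)`_m =
  (nb_forests e i m.+1)%:R.
Proof.
move=> mn; rewrite nb_forestsS natr_sum mulr_suml coef_sum.
apply: eq_bigr => j _; rewrite coefM natr_sum; apply: eq_bigr => k _.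
by rewrite !coef_poly natrM (leq_ltn_trans (leq_subr _ _) mn) (leq_trans (ltn_ord k) mn).
Qed.

(** The recursion [nb_forestsS] in generating-function form: a forest is a sequence of trees, so its
    series is the inverse of one minus the series of the allowed trees. *)
Lemma forest_poly_eqmod n i :
  eqmodXn n (forest_poly n i * (1 - 'X * \sum_(j | e i j) forest_poly n j)) 1.
Proof.
apply/dvdXnP => m mn; rewrite mulrBr mulr1 mulrCA (mulrC (forest_poly n i)).
rewrite !coefB coefXM coef_poly mn coef1; case: m mn => [|m] mn.
  by rewrite nb_forests0 subr0 subrr.
by rewrite /= coef_forest_poly_mul ?subrr ?subr0 // ltnW.
Qed.

(** Induction on the truncation order. Up to truncation [F_i = 1 + x (sum_j F_j) F_i], so the bound
    [2] at order [n] gives [1 + rho * |T| * 2 * 2 <= 2] at order [n + 1]. *)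
Lemma forest_poly_norm_le n i (rho : K) :
  0 <= rho -> 4 * #|T|%:R * rho <= 1 -> poly_norm rho (forest_poly n i) <= 2.
Proof.
move=> r0 r1; elim: n i => [|n IHn] i.
  by rewrite /forest_poly poly_def big_ord0 poly_norm0.
rewrite (@poly_norm_wide _ n.+1) ?size_poly // big_ord_recl.
rewrite coef_poly nb_forests0 normr1 mulr1 -[2]/(1 + 1) lerD2l.
set q := (\sum_(j | e i j) forest_poly n j) * forest_poly n i.
have qn : poly_norm rho q <= #|T|%:R * 2 * 2.
  rewrite (le_trans (poly_normM _ _ r0)) // ler_pM ?poly_norm_ge0 //.
  rewrite (le_trans (poly_norm_sum _ _ _ r0)) //.
  rewrite (le_trans (ler_sum _ (fun j _ => IHn j))) //.
  rewrite sumr_const -[2 *+ _]mulr_natl ler_wpM2r // ler_nat.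
  exact: max_card.
apply: le_trans r1; have -> : 4 * #|T|%:R * rho = #|T|%:R * 2 * 2 * rho by ring.
apply: le_trans (ler_wpM2r r0 qn).
(* Beyond the constant term, [forest_poly n.+1] has the coefficients of [q] below order [n]; the
   other coefficients of [q] can only enlarge its norm. *)
rewrite (@poly_norm_wide _ (maxn n (size q))) ?leq_maxr // mulr_suml.
rewrite (big_ord_widen (maxn n (size q))
  (fun m => `|(forest_poly n.+1 i)`_m.+1| * rho ^+ m.+1)) ?leq_maxl //=.
rewrite big_mkcond; apply: ler_sum => m _ /=; case: ifP => [mn|_]; last first.
  by rewrite !mulr_ge0 ?exprn_ge0.
by rewrite coef_forest_poly_mul // coef_poly ltnS mn exprSr mulrA.
Qed.

Lemma nb_forests_le n i (rho : K) :
  0 <= rho -> 4 * #|T|%:R * rho <= 1 -> (nb_forests e i n)%:R * rho ^+ n <= 2.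
Proof.
move=> r0 r1; apply: le_trans (forest_poly_norm_le n.+1 i r0 r1).
rewrite (@poly_norm_wide _ n.+1) ?size_poly // big_ord_recr /= coef_poly ltnSn.
by rewrite normr_nat lerDr sumr_ge0 // => m _; rewrite mulr_ge0 ?exprn_ge0.
Qed.

End ForestSeries.

Lemma sum_ord_interval (V : zmodType) (l m n : nat) (F : 'I_l -> V) :
  (m <= n)%N ->
  \sum_(q < l | (m <= q < n)%N) F q =
  \sum_(q < l | (q < n)%N) F q - \sum_(q < l | (q < m)%N) F q.
Proof.
move=> mn; apply/eqP; rewrite eq_sym subr_eq addrC.
rewrite (bigID (fun q : 'I_l => (q < m)%N)) /=; apply/eqP.
congr (_ + _); apply: eq_bigl => q; last by rewrite -leqNgt andbC.
by rewrite andb_idl // => /leq_trans; apply.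
Qed.

(** * Blocks of labels of the staircase and their neighbours *)

Section StaircaseLabels.
Implicit Types (a : seq nat) (lambda : seq nat).

Lemma size_part_of_mult bm : size (part_of_mult bm) = sumn [seq p.2 | p <- bm].
Proof. by elim: bm => //= p bm IH; rewrite size_cat size_nseq IH. Qed.

Lemma nth_part_of_mult bm k p :
  (sumn (take k [seq q.2 | q <- bm]) <= p < sumn (take k.+1 [seq q.2 | q <- bm]))%N ->
  nth 0%N (part_of_mult bm) p = (nth (0%N, 0%N) bm k).1.
Proof.
have takeS k' b' m' bm' : sumn (take k'.+1 [seq q.2 | q <- (b', m') :: bm']) =
    (m' + sumn (take k' [seq q.2 | q <- bm']))%N by [].
elim: bm k p => [|[b m] bm IH] [|k] p //; rewrite !takeS.
  by rewrite !take0 addn0 /= nth_cat size_nseq nth_nseq => ->.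
move=> /andP[mp pm]; have /IH /= <- : (sumn (take k [seq q.2 | q <- bm]) <= p - m <
  sumn (take k.+1 [seq q.2 | q <- bm]))%N by lia.
by rewrite nth_cat size_nseq ltnNge (leq_trans (leq_addr _ _) mp).
Qed.

(** The [A_k] of the overview. *)
Definition psum a k := sumn (take k a).

Lemma map_snd_staircase a :
  [seq q.2 | q <- [seq (sumn (take (size a - i) a), nth 0%N a i) | i <- iota 0 (size a)]]
  = a.
Proof. by rewrite -map_comp -[RHS](mkseq_nth 0%N). Qed.

Lemma size_staircase a : size (staircase a) = sumn a.
Proof. by rewrite size_part_of_mult map_snd_staircase. Qed.

Lemma nth_staircase a k p : (k < size a)%N -> (psum a k <= p < psum a k.+1)%N ->
  nth 0%N (staircase a) p = psum a (size a - k).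
Proof.
move=> ka pk; rewrite (@nth_part_of_mult _ k) ?map_snd_staircase //.
by rewrite (nth_map 0%N) ?size_iota //= nth_iota.
Qed.

Lemma psum0 a : psum a 0 = 0%N.
Proof. by rewrite /psum take0. Qed.

Lemma psum_size a : psum a (size a) = sumn a.
Proof. by rewrite /psum take_size. Qed.

Lemma leq_psum a k m : (k <= m)%N -> (psum a k <= psum a m)%N.
Proof.
move=> km; rewrite /psum -(cat_take_drop k (take m a)) sumn_cat take_takel //.
exact: leq_addr.
Qed.

Lemma psum_block a p : (p < sumn a)%N ->
  exists2 k, (k < size a)%N & (psum a k <= p < psum a k.+1)%N.
Proof.
rewrite -psum_size => pa; have /ex_minnP[k kP kmin] : exists k, (p < psum a k)%N.
  by exists (size a).
case: k kP kmin => [|k]; first by rewrite psum0.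
move=> kP kmin; exists k; first exact: kmin.
by rewrite kP andbT leqNgt; apply/negP => /kmin; rewrite ltnn.
Qed.

(** Self-conjugacy makes the second condition follow from the first. With [r = size a], if
    [q < A_(r-k)] lies between [A_m] and [A_(m+1)], then [m < r - k], so [k + 1 <= r - m] and
    [p < A_(k+1) <= A_(r-m)]. *)
Lemma label_adj_staircase a k (p q : 'I_(size (staircase a))) :
  (k < size a)%N -> (psum a k <= p < psum a k.+1)%N ->
  label_adj p q = (q < psum a (size a - k))%N.
Proof.
move=> ka pk; rewrite /label_adj /young_diagram /= !ltn_ord /= (nth_staircase ka pk).
apply: andb_idr => qk; have qa : (q < sumn a)%N by rewrite -size_staircase.
have [m ma qm] := psum_block qa; rewrite (nth_staircase ma qm).
have mk : (m < size a - k)%N.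
  rewrite ltnNge; apply/negP => /(leq_psum a).
  by move: qm => /andP[qm _] /leq_trans /(_ qm); rewrite leqNgt qk.
case/andP: pk => _ /leq_trans; apply; apply: leq_psum; lia.
Qed.

End StaircaseLabels.

(** * The series of labelled trees *)

Section TreeSeries.
Variable K : numFieldType.

(** The extra factor ['X] makes this a truncation of [G(z) = sum_k C_k / (l z)^(k+1)] in the
    variable [x = 1 / (l z)]. *)
Definition tree_poly (lambda : seq nat) n : {poly K} :=
  \poly_(m < n) (lambda_tree_count lambda m)%:R * 'X.

Lemma tree_polyE lambda n :
  tree_poly lambda n = 'X * \sum_i forest_poly K (@label_adj lambda) n i.
Proof.
rewrite /tree_poly mulrC; congr (_ * _); apply/polyP => m.
rewrite coef_poly coef_sum; under eq_bigr do rewrite coef_poly.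
by case: ltnP => _; rewrite ?big1_eq // lambda_tree_countE natr_sum.
Qed.

Lemma tree_poly_norm_le lambda n (rho : K) :
  0 <= rho -> 4 * (size lambda)%:R * rho <= 1 ->
  poly_norm rho (tree_poly lambda n) <= (size lambda)%:R * 2 * rho.
Proof.
move=> r0 r1; rewrite tree_polyE mulrC poly_normMX ler_wpM2r //.
apply: le_trans (poly_norm_sum _ _ _ r0) _.
apply: le_trans (ler_sum _ (fun i _ => forest_poly_norm_le _ n i r0 _)) _.
  by rewrite card_ord.
by rewrite sumr_const card_ord mulr_natl.
Qed.

Lemma lambda_tree_count_le lambda k (rho : K) :
  0 <= rho -> 4 * (size lambda)%:R * rho <= 1 ->
  (lambda_tree_count lambda k)%:R * rho ^+ k <= (size lambda)%:R * 2.
Proof.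
move=> r0 r1; rewrite lambda_tree_countE natr_sum mulr_suml.
apply: le_trans (ler_sum _ (fun i _ => nb_forests_le _ k i r0 _)) _.
  by rewrite card_ord.
by rewrite sumr_const card_ord mulr_natl.
Qed.

(** The abstract equation is applied to the truncations of the [s_k]; what has to be checked is the
    block relation [sP]. *)
Lemma stair_poly_tree_dvd a n :
  'X^n %| (stair_poly K (psum a) (size a)).[tree_poly (staircase a) n].
Proof.
set l := size (staircase a); pose F := forest_poly K (@label_adj (staircase a)) n.
pose s k := 1 - 'X * \sum_(q < l | (q < psum a k)%N) F q.
have -> : tree_poly (staircase a) n = 1 - s (size a).
  rewrite /s opprB addrC subrK tree_polyE; congr (_ * _); apply: eq_bigl => q.
  by rewrite psum_size -size_staircase ltn_ord.
apply: stair_poly_dvd; first exact: psum0.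
  by rewrite /s psum0 big_pred0 // mulr0 subr0.
move=> k ka.
have kk := leq_psum a (leqnSn k).
have -> : s k - s k.+1 = 'X * \sum_(q < l | (psum a k <= q < psum a k.+1)%N) F q.
  by rewrite sum_ord_interval // mulrBr /s opprB addrC addrA subrK.
have -> : ((psum a k.+1)%:R - (psum a k)%:R) *: 'X =
    'X * \sum_(q < l | (psum a k <= q < psum a k.+1)%N) 1 :> {poly K}.
  have kl m : (m <= size a)%N -> \sum_(q < l | (q < psum a m)%N) 1 = (psum a m)%:R :> {poly K}.
    move=> /(leq_psum a); rewrite psum_size -size_staircase -/l => ml.
    by rewrite -(big_ord_widen l (fun=> 1)) // sumr_const card_ord.
  by rewrite sum_ord_interval // !kl // 1?ltnW // -mul_polyC mulrC raddfB /= !polyC_natr.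
(* For [q] in block [k + 1] the sum in [s_(r-k)] runs exactly over the neighbours of [q], so every
   label of the block contributes [F_q s_(r-k) = 1]. *)
rewrite -mulrA; apply: eqmodXnM (eqmodXn_refl _ _) _; rewrite mulr_suml.
apply: eqmodXn_sum => q qk; rewrite /s -(eq_bigl _ _ (fun p => label_adj_staircase p ka qk)).
exact: forest_poly_eqmod.
Qed.

End TreeSeries.

(** * The polynomial in [G] and [z], and its degrees *)

Section CauchyPoly.
Variables (K : fieldType) (A : nat -> nat) (r : nat).

(** [stair_poly] at [x = 1 / (l z)] with denominators cleared: in each product every one of the [r]
    factors absorbs one [z]. The outer variable is [G], the inner one [z]. *)
Definition cauchy_poly (l : K) : {poly {poly K}} :=
  (1 - 'X) * \prod_(k < r) ('X%:P * (1 - 'X) + (stair_num K A r k / l)%:P%:P)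
  - \prod_(k < r) ('X%:P * (1 - 'X) + (stair_den K A r k / l)%:P%:P).

Lemma cauchy_polyE (l g z : K) : l != 0 -> z != 0 ->
  (cauchy_poly l).[g, z] = z ^+ r * (stair_poly K A r).[g, (l * z)^-1].
Proof.
move=> l0 z0.
have fac (c : nat -> K) :
    (\prod_(k < r) ('X%:P * (1 - 'X) + (c k / l)%:P%:P)).[g, z] =
    z ^+ r * (\prod_(k < r) (1 - 'X + (c k *: 'X)%:P)).[g, (l * z)^-1].
  rewrite !horner_prod -[in z ^+ r](card_ord r) -prodr_const -big_split /=.
  apply: eq_bigr => k _; by rewrite !hornerE; field; rewrite l0 z0.
rewrite /cauchy_poly /stair_poly !(hornerD, hornerN, hornerM) !fac.
by rewrite !hornerE /= [_ * z ^+ r]mulrC -mulrA -mulrBr.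
Qed.

Lemma size_1subX (S : nzRingType) : size (1 - 'X : {poly S}) = 2%N.
Proof. by rewrite -opprB size_polyN size_XsubC. Qed.

Lemma lead_coef_1subX (S : nzRingType) : lead_coef (1 - 'X : {poly S}) = -1.
Proof. by rewrite -opprB lead_coefN lead_coefXsubC. Qed.

Lemma size_factor (S : idomainType) (u c : S) : u != 0 ->
  size (u%:P * (1 - 'X) + c%:P) = 2%N.
Proof.
move=> u0; have s2 : size (u%:P * (1 - 'X)) = 2%N.
  by rewrite size_Cmul // size_1subX.
by rewrite size_polyDl s2 // ltnS size_polyC_leq1.
Qed.

Lemma lead_coef_factor (S : idomainType) (u c : S) : u != 0 ->
  lead_coef (u%:P * (1 - 'X) + c%:P) = - u.
Proof.
move=> u0; rewrite lead_coefDl ?lead_coefM ?lead_coefC ?lead_coef_1subX ?mulrN1 //.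
by rewrite size_Cmul // size_1subX ltnS size_polyC_leq1.
Qed.

Lemma size_prod_linear (S : idomainType) (f : 'I_r -> {poly S}) :
  (forall k, size (f k) = 2%N) -> size (\prod_(k < r) f k) = r.+1.
Proof.
move=> f2; rewrite size_prod => [|k _]; last by rewrite -size_poly_gt0 f2.
under eq_bigr do rewrite f2.
by rewrite sum_nat_const card_ord muln2 -addnn -addSn addnK.
Qed.

Lemma size_prod_factor (c : nat -> K) :
  size (\prod_(k < r) ('X%:P * (1 - 'X) + (c k)%:P%:P : {poly {poly K}})) = r.+1.
Proof. by apply: size_prod_linear => k; rewrite size_factor ?polyX_eq0. Qed.

(** The first product has degree [r + 1] in [G] and the second only [r], so the leading terms cannot
    cancel. *)
Lemma size_cauchy_poly l : size (cauchy_poly l) = r.+2.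
Proof.
have num := size_prod_factor (fun k => stair_num K A r k / l).
have den := size_prod_factor (fun k => stair_den K A r k / l).
have s1 : size ((1 - 'X) * \prod_(k < r) ('X%:P * (1 - 'X) +
    (stair_num K A r k / l)%:P%:P : {poly {poly K}})) = r.+2.
  by rewrite size_mul -?size_poly_gt0 ?num ?(size_1subX {poly K}).
by rewrite size_polyDl s1 // size_polyN den.
Qed.

(** Every factor is linear in [z] and [1 - G] is free of [z], so the degree in [z] is at most [r].
    It is attained because the coefficient of [G^(r+1)] is [- (- z)^r]. *)
Lemma sizeY_cauchy_poly l : sizeY (cauchy_poly l) = r.+1.
Proof.
apply/eqP; rewrite eqn_leq; apply/andP; split.
  rewrite sizeYE /cauchy_poly rmorphB rmorphM !rmorph_prod /=.
  have H : swapXY (1 - 'X) = (1 - 'X)%:P :> {poly {poly K}}.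
    by rewrite rmorphB rmorph1 /= swapXY_X polyCB.
  have H0 : 1 - 'X != 0 :> {poly K} by rewrite -size_poly_gt0 size_1subX.
  have f2 (c : nat -> K) : size (\prod_(k < r)
      swapXY ('X%:P * (1 - 'X) + (c k)%:P%:P)) = r.+1.
    apply: size_prod_linear => k; rewrite rmorphD rmorphM /= H swapXY_Y.
    rewrite swapXY_polyC map_polyC /= mulrC size_polyDl size_Cmul // size_polyX //.
    by rewrite ltnS size_polyC_leq1.
  rewrite (leq_trans (size_polyD _ _)) // size_polyN geq_max.
  rewrite (f2 (fun k => stair_den K A r k / l)) leqnn andbT.
  by rewrite H size_Cmul // (f2 (fun k => stair_num K A r k / l)).
have <- : size (lead_coef (cauchy_poly l)) = r.+1.
  rewrite lead_coefDl.
    rewrite lead_coefM lead_coef_1subX lead_coef_prod.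
    under eq_bigr do rewrite lead_coef_factor ?polyX_eq0 //.
    rewrite prodr_const card_ord mulN1r size_polyN exprNn -signr_odd.
    by rewrite size_Msign size_polyXn.
  have num := size_prod_factor (fun k => stair_num K A r k / l).
  rewrite size_polyN (size_prod_factor (fun k => stair_den K A r k / l)).
  by rewrite size_mul -?size_poly_gt0 ?num ?(size_1subX {poly K}).
exact: max_size_lead_coefXY.
Qed.

End CauchyPoly.

(** * The Cauchy transform *)

Lemma normc_leD (R : realType) (z : R[i]) (a b : R) :
  `|complex.Re z| <= a -> `|complex.Im z| <= b -> `|z| <= (a + b)%:C.
Proof.
move=> za zb; rewrite [z]complexE (le_trans (ler_normD _ _)) //.
have nR (x : R) : `|x%:C| = `|x|%:C :> R[i].
  by rewrite normc_def /= expr0n addr0 sqrtr_sqr.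
rewrite normrM !nR rmorphD lerD ?lecR // normc_def /= expr0n expr1n add0r sqrtr1.
by rewrite mul1r lecR.
Qed.

Lemma Im_le_normc (R : realType) (z : R[i]) : `|complex.Im z|%:C <= `|z|.
Proof.
have := normc_ge_Re (z * 'i); rewrite ReiNIm normrN normrM.
by rewrite [X in _ * X]normc_def /= expr0n expr1n add0r sqrtr1 mulr1.
Qed.

(** * Integration of complex-valued functions by components *)

Section ComplexIntegral.
Variables (d : measure_display) (T : measurableType d) (R : realType).
Variable mu : {measure set T -> \bar R}.
Implicit Types f g : T -> R[i].

Definition cmeasurable f :=
  measurable_fun setT (fun x => complex.Re (f x)) /\
  measurable_fun setT (fun x => complex.Im (f x)).

Definition cintegrable f :=
  mu.-integrable setT (fun x => (complex.Re (f x))%:E) /\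
  mu.-integrable setT (fun x => (complex.Im (f x))%:E).

Definition cintegral f : R[i] :=
  (\int[mu]_x complex.Re (f x)) +i* (\int[mu]_x complex.Im (f x)).

Lemma cmeasurable_cst c : cmeasurable (fun=> c).
Proof. by split; exact: measurable_cst. Qed.

Lemma cmeasurableM f g : cmeasurable f -> cmeasurable g ->
  cmeasurable (fun x => f x * g x).
Proof.
move=> [fr fi] [gr gi]; split.
  rewrite (_ : (fun _ => _) = (fun x => complex.Re (f x) * complex.Re (g x) -
    complex.Im (f x) * complex.Im (g x))).
    by apply: measurable_funB; exact: measurable_funM.
  by apply/funext => x; case: (f x) (g x) => [a b] [].
rewrite (_ : (fun _ => _) = (fun x => complex.Re (f x) * complex.Im (g x) +
  complex.Im (f x) * complex.Re (g x))).
  by apply: measurable_funD; exact: measurable_funM.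
by apply/funext => x; case: (f x) (g x) => [a b] [].
Qed.

Lemma cmeasurableX f n : cmeasurable f -> cmeasurable (fun x => f x ^+ n).
Proof.
move=> mf; elim: n => [|n IH]; first exact: cmeasurable_cst.
rewrite (_ : (fun _ => _) = (fun x => f x * f x ^+ n)); first exact: cmeasurableM.
by apply/funext => x; rewrite exprS.
Qed.

Lemma cintegrableD f g : cintegrable f -> cintegrable g ->
  cintegrable (fun x => f x + g x).
Proof.
move=> [fr fi] [gr gi]; split.
  rewrite (_ : (fun _ => _) = ((fun x => (complex.Re (f x))%:E) \+
    (fun x => (complex.Re (g x))%:E))%E); first exact: integrableD.
  by apply/funext => x; rewrite /= raddfD EFinD.
rewrite (_ : (fun _ => _) = ((fun x => (complex.Im (f x))%:E) \+
  (fun x => (complex.Im (g x))%:E))%E); first exact: integrableD.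
by apply/funext => x; rewrite /= raddfD EFinD.
Qed.

Lemma cintegralD f g : cintegrable f -> cintegrable g ->
  cintegral (fun x => f x + g x) = cintegral f + cintegral g.
Proof.
move=> [fr fi] [gr gi]; rewrite /cintegral; apply/eqP; rewrite eq_complex /=.
rewrite -!RintegralD //; apply/andP; split; apply/eqP; congr (Rintegral _ _ _).
  by apply/funext => x; rewrite raddfD.
by apply/funext => x; rewrite raddfD.
Qed.

Lemma cintegrableZ (c : R[i]) f : cintegrable f -> cintegrable (fun x => c * f x).
Proof.
move=> [fr fi]; case: c => a b; split.
  rewrite (_ : (fun _ => _) = ((fun x => a%:E * (complex.Re (f x))%:E) \+
    (fun x => (- b)%:E * (complex.Im (f x))%:E))%E).
    by apply: integrableD => //; exact: integrableZl.
  by apply/funext => x /=; rewrite -!EFinM -EFinD; case: (f x) => u v /=; rewrite mulNr.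
rewrite (_ : (fun _ => _) = ((fun x => a%:E * (complex.Im (f x))%:E) \+
  (fun x => b%:E * (complex.Re (f x))%:E))%E).
  by apply: integrableD => //; exact: integrableZl.
by apply/funext => x /=; rewrite -!EFinM -EFinD; case: (f x).
Qed.

Lemma cintegralZ (c : R[i]) f : cintegrable f ->
  cintegral (fun x => c * f x) = c * cintegral f.
Proof.
move=> [fr fi]; case: c => a b; rewrite /cintegral; apply/eqP; rewrite eq_complex /=.
have Z k (h : T -> R) : mu.-integrable setT (fun x => (h x)%:E) ->
    mu.-integrable setT (fun x => (k * h x)%:E).
  by move=> hi; exact: (integrableZl measurableT k hi).
rewrite -mulNr -!RintegralZl // -!RintegralD //; try exact: Z.
apply/andP; split; apply/eqP; congr (Rintegral _ _ _); apply/funext => x.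
  by case: (f x) => u v /=; rewrite mulNr.
by case: (f x).
Qed.

Lemma cintegrable0 : cintegrable (fun=> 0).
Proof. by split; exact: integrable0. Qed.

Lemma cintegral0 : cintegral (fun=> 0) = 0.
Proof. by rewrite /cintegral /Rintegral !integral0. Qed.

Lemma cintegrable_sum n (f : nat -> T -> R[i]) :
  (forall k, cintegrable (f k)) -> cintegrable (fun x => \sum_(k < n) f k x).
Proof.
move=> fi; elim: n => [|n IH].
  rewrite (_ : (fun _ => _) = fun=> 0); first exact: cintegrable0.
  by apply/funext => x; rewrite big_ord0.
rewrite (_ : (fun _ => _) = fun x => \sum_(k < n) f k x + f n x).
  exact: cintegrableD.
by apply/funext => x; rewrite big_ord_recr.
Qed.

Lemma cintegral_sum n (f : nat -> T -> R[i]) :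
  (forall k, cintegrable (f k)) ->
  cintegral (fun x => \sum_(k < n) f k x) = \sum_(k < n) cintegral (f k).
Proof.
move=> fi; elim: n => [|n IH].
  rewrite big_ord0 -[RHS]cintegral0; congr cintegral.
  by apply/funext => x; rewrite big_ord0.
rewrite big_ord_recr /= -IH -cintegralD //; last exact: cintegrable_sum.
by congr cintegral; apply/funext => x; rewrite big_ord_recr.
Qed.

(** The factor [2] comes from bounding the real and imaginary parts separately. It is harmless, as
    only rates of decay in [n] matter later. *)
Lemma cintegral_dominated f (b : T -> R) :
  cmeasurable f -> mu.-integrable setT (fun x => (b x)%:E) ->
  (forall x, `|f x| <= (b x)%:C) ->
  cintegrable f /\ `|cintegral f| <= (2 * \int[mu]_x b x)%:C.
Proof.
move=> [mr mi] bi fb.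
have rb x : `|complex.Re (f x)| <= b x.
  by rewrite -lecR (le_trans (normc_ge_Re _)).
have ib x : `|complex.Im (f x)| <= b x.
  by rewrite -lecR (le_trans (Im_le_normc _)).
have dom (h : T -> R) : measurable_fun setT h -> (forall x, `|h x| <= b x) ->
    mu.-integrable setT (fun x => (h x)%:E) /\ `|\int[mu]_x h x| <= \int[mu]_x b x.
  move=> mh hb; have hi : mu.-integrable setT (fun x => (h x)%:E).
    apply: (le_integrable measurableT _ _ bi); first exact/measurable_EFinP.
    by move=> x _; rewrite /= lee_fin (le_trans (hb x)) // ler_norm.
  split=> //; apply: le_trans (le_normr_Rintegral measurableT hi) _.
  apply: le_Rintegral => //; exact: (integrable_norm hi).
have [? ?] := dom _ mr rb; have [? ?] := dom _ mi ib.
by split=> //; rewrite mulr2n mulrDl !mul1r; apply: normc_leD.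
Qed.

End ComplexIntegral.

(** The exact remainder allows termwise integration of a finite sum. It serves both at infinity
    ([u = z], [v = x]) and around a point ([u = w - x], [v = - s]). *)
Lemma geometric_expansion (K : fieldType) (u v : K) n :
  u != 0 -> u - v != 0 ->
  (u - v)^-1 = \sum_(k < n) v ^+ k * u ^- k.+1 + v ^+ n * (u ^- n * (u - v)^-1).
Proof.
move=> u0 uv; elim: n => [|n IH].
  by rewrite big_ord0 add0r !expr0 invr1 !mul1r.
rewrite big_ord_recr /= -addrA [LHS]IH; congr (_ + _).
rewrite !exprS; field.
by rewrite uv u0 expf_neq0.
Qed.

Lemma sum_geometric_le (K : numFieldType) (q : K) n : 0 <= q < 1 ->
  \sum_(k < n) q ^+ k <= (1 - q)^-1.
Proof.
move=> /andP[q0 q1]; have q1' : 0 < 1 - q by rewrite subr_gt0.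
rewrite -[leRHS]mul1r ler_pdivlMr // mulrC -[1 - q]opprB mulNr -subrX1 opprB.
by rewrite gerBl exprn_ge0.
Qed.

(** The inequalities force [C] and [t] to be real, so the limit of [C t^n] can be taken in [R]. *)
Lemma eq0_geometric (R : realType) (x C t : R[i]) :
  0 <= t < 1 -> (forall n, `|x| <= C * t ^+ n) -> x = 0.
Proof.
move=> /andP[t0 t1] xC; apply/eqP; rewrite -normr_le0.
have C0 : 0 <= C by have := xC 0%N; rewrite mulr1; apply: le_trans.
have real (y : R[i]) : 0 <= y -> y = (complex.Re y)%:C.
  by move=> /ger0_real/RRe_real.
rewrite [ `|x|]real // -[0]/(0%:C) lecR; move: xC t1.
rewrite (real _ t0) (real _ C0) [ `|x|]real // -[1]/(1%:C) ltcR => xC t1.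
have t0' : 0 <= complex.Re t by rewrite -lecR -real.
have cv : geometric (complex.Re C) (complex.Re t) @ \oo --> 0.
  by apply: cvg_geometric; rewrite ger0_norm.
rewrite -(cvg_lim _ cv) //; apply: limr_ge; first exact: cvgP cv.
by apply: nearW => n; rewrite /geometric /= -lecR rmorphM rmorphXn.
Qed.

(** * The resolvent [1 / (z - x)] off the real axis *)

Section Resolvent.
Variable R : realType.
Implicit Types z w : R[i].

Lemma Im_neq0 z : z \isn't Num.real -> complex.Im z != 0.
Proof. by case: z => a b; rewrite complex_real. Qed.

Lemma subr_real_neq0 z (x : R) : complex.Im z != 0 -> z - x%:C != 0.
Proof.
apply: contra => /eqP/(congr1 (@complex.Im R)); rewrite raddfB /= subr0 => ->.
by [].
Qed.

Lemma norm_resolvent_le z (x : R) : complex.Im z != 0 ->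
  `|(z - x%:C)^-1| <= (`|complex.Im z|^-1)%:C.
Proof.
move=> z0; rewrite normfV fmorphV lef_pV2 ?posrE.
- by have := Im_le_normc (z - x%:C); rewrite raddfB /= subr0.
- by rewrite normr_gt0 subr_real_neq0.
- by rewrite -[0]/(0%:C) ltcR normr_gt0.
Qed.

Lemma cmeasurable_resolvent z : complex.Im z != 0 ->
  cmeasurable (T := measurableTypeR R) (fun x => (z - x%:C)^-1).
Proof.
case: z => a b /= b0.
have D0 (x : R) : (a - x) ^+ 2 + b ^+ 2 != 0.
  by rewrite paddr_eq0 ?sqr_ge0 // !expf_eq0 /= (negPf b0) andbF.
have cx : continuous (fun x : R => a - x).
  by move=> x; apply: cvgB; [exact: cvg_cst | exact: cvg_id].
have cD : continuous (fun x : R => ((a - x) ^+ 2 + b ^+ 2)^-1).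
  move=> x; apply: cvgV => //; apply: cvgD; last exact: cvg_cst.
  by rewrite expr2; under eq_fun do rewrite expr2; apply: cvgM; exact: cx.
split; apply: continuous_measurable_fun.
  rewrite (_ : (fun _ => _) = (fun x => (a - x) * ((a - x) ^+ 2 + b ^+ 2)^-1)).
    by move=> x; apply: cvgM; [exact: cx | exact: cD].
  by apply/funext => x; rewrite /= oppr0 addr0.
rewrite (_ : (fun _ => _) = (fun x => - b * ((a - x) ^+ 2 + b ^+ 2)^-1)).
  by move=> x; apply: cvgM; [exact: cvg_cst | exact: cD].
by apply/funext => x; rewrite /= oppr0 addr0 mulNr.
Qed.

End Resolvent.

(** * Expansions of the Cauchy transform, at a point and at infinity *)

Section CauchyTransform.
Variables (R : realType) (F : probability (measurableTypeR R) R).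
Implicit Types z w : R[i].
Local Notation G := (cauchy_transform F).

Lemma cauchy_transformE z : G z = cintegral F (fun x => (z - x%:C)^-1).
Proof.
by congr (_ +i* _); congr (Rintegral _ _ _); apply/funext => x; rewrite mul1r.
Qed.

Lemma cintegral_bounded (f : measurableTypeR R -> R[i]) (B : R[i]) :
  cmeasurable f -> (forall x, `|f x| <= B) ->
  cintegrable F f /\ `|cintegral F f| <= 2 * B.
Proof.
move=> mf fB; have B0 : 0 <= B by apply: le_trans (fB 0); rewrite normr_ge0.
have BE := RRe_real (ger0_real B0); rewrite -BE in fB *.
have [] := @cintegral_dominated _ _ _ F f (fun=> complex.Re B) mf _ fB.
  exact: finite_measure_integrable_cst.
have FT : fine (F setT) = 1 by rewrite probability_setT.
move=> fi; rewrite Rintegral_cst // FT mulr1 => h; split=> //.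
by rewrite (le_trans h) // rmorphM /= rmorph_nat.
Qed.

(** Up to the sign [(-1)^k], the Taylor coefficients of [G] at [w]. *)
Definition resolvent_moment w (k : nat) : R[i] :=
  cintegral F (fun x => (w - x%:C) ^- k.+1).

Lemma cintegral_resolventX w k : complex.Im w != 0 ->
  cintegrable F (fun x => (w - x%:C) ^- k.+1) /\
  `|resolvent_moment w k| <= 2 * (`|complex.Im w| ^- k.+1)%:C.
Proof.
move=> w0; apply: cintegral_bounded => [|x].
  by under eq_fun do rewrite -exprVn; apply/cmeasurableX/cmeasurable_resolvent.
rewrite -!exprVn normrX rmorphXn lerXn2r ?nnegrE ?normr_ge0 ?norm_resolvent_le //.
by rewrite -[0]/(0%:C) lecR invr_ge0.
Qed.

Lemma norm_cauchy_transform_le w : complex.Im w != 0 ->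
  `|G w| <= 2 * (`|complex.Im w|^-1)%:C.
Proof.
move=> w0; rewrite cauchy_transformE.
by have [] := cintegral_bounded (cmeasurable_resolvent w0) (fun x => @norm_resolvent_le R w x w0).
Qed.

Definition taylor_poly w n : {poly R[i]} :=
  \poly_(k < n) ((-1) ^+ k * resolvent_moment w k).

(** The geometric expansion of [1 / ((w - x) + s)] in powers of [s], integrated. In the remainder
    [1 / (w + s - x)] is at most [1 / |Im (w + s)|], so the error decays for [|s| < |Im w|]. *)
Lemma cauchy_taylor w s n :
  complex.Im w != 0 -> complex.Im (w + s) != 0 ->
  `|(taylor_poly w n).[s] - G (w + s)| <=
  2 * (`|complex.Im (w + s)|^-1)%:C * (`|s| * (`|complex.Im w|^-1)%:C) ^+ n.
Proof.
move=> w0 ws0; rewrite distrC cauchy_transformE.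
have exp_ws (x : R) : (w + s - x%:C)^-1 =
    \sum_(k < n) (- s) ^+ k * (w - x%:C) ^- k.+1
    + (- s) ^+ n * ((w - x%:C)^-1 ^+ n * (w + s - x%:C)^-1).
  have -> : w + s - x%:C = (w - x%:C) - (- s) by rewrite opprK addrAC.
  rewrite [LHS](geometric_expansion n) ?subr_real_neq0 ?exprVn //.
  by rewrite opprK addrAC subr_real_neq0.
have res k := (cintegral_resolventX k w0).1.
have resZ k := cintegrableZ ((- s) ^+ k) (res k).
have [remi rem_le] : cintegrable F (fun x => (w - x%:C)^-1 ^+ n * (w + s - x%:C)^-1) /\
    `|cintegral F (fun x => (w - x%:C)^-1 ^+ n * (w + s - x%:C)^-1)| <=
    2 * ((`|complex.Im w|^-1)%:C ^+ n * (`|complex.Im (w + s)|^-1)%:C).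
  apply: cintegral_bounded => [|x].
    apply: cmeasurableM; first exact/cmeasurableX/cmeasurable_resolvent.
    exact: cmeasurable_resolvent.
  rewrite normrM normrX ler_pM ?exprn_ge0 ?norm_resolvent_le //.
  rewrite lerXn2r ?nnegrE ?norm_resolvent_le //.
  by rewrite -[0]/(0%:C) lecR invr_ge0.
under eq_fun do rewrite exp_ws.
rewrite cintegralD; last exact: cintegrableZ.
  rewrite (cintegral_sum _ resZ) cintegralZ // horner_poly addrAC.
  under eq_bigr do rewrite cintegralZ // -mulN1r exprMn mulrAC.
  rewrite subrr add0r normrM normrX normrN exprMn.
  rewrite (le_trans (ler_wpM2l _ rem_le)) ?exprn_ge0 //.
  by rewrite le_eqVlt; apply/orP; left; apply/eqP; ring.
exact: (cintegrable_sum _ resZ).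
Qed.

(** The coefficients are at most [2 / |Im w|^(k+1)], and the resulting geometric series bounds all
    truncations at once. *)
Lemma taylor_poly_norm_le w (rho : R[i]) n :
  0 <= rho < `|complex.Im w|%:C ->
  poly_norm rho (taylor_poly w n) <=
  2 * (`|complex.Im w|^-1)%:C * (1 - rho * (`|complex.Im w|^-1)%:C)^-1.
Proof.
move=> /andP[r0 rw]; have w0 : complex.Im w != 0.
  by rewrite -normr_gt0 -ltcR (le_lt_trans r0).
have y0 : 0 < `|complex.Im w|%:C by apply: le_lt_trans rw.
rewrite (@poly_norm_wide _ n) ?size_poly //.
apply: le_trans (ler_wpM2l _ (sum_geometric_le n _)); last 2 first.
- by rewrite mulr_ge0 // fmorphV invr_ge0 ltW.
- rewrite fmorphV mulr_ge0 ?invr_ge0 ?(ltW y0) //=.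
  by rewrite ltr_pdivrMr // mul1r.
rewrite mulr_sumr; apply: ler_sum => k _.
rewrite coef_poly ltn_ord normrM normrX normrN1 expr1n mul1r exprMn.
rewrite [leRHS]mulrCA [leRHS]mulrC ler_wpM2r ?exprn_ge0 //.
rewrite (le_trans (cintegral_resolventX k w0).2) //.
by rewrite -exprVn rmorphXn exprS mulrA.
Qed.

Section Moments.
Variable lambda : seq nat.
Hypothesis F_lambda : is_F_lambda lambda F.

Definition tree_moment n : R := (lambda_tree_count lambda n)%:R / (size lambda)%:R ^+ n.+1.

Lemma F_setC0 : F (~` `[0, +oo[) = 0%E.
Proof. by rewrite probability_setC // F_lambda.1 subee. Qed.

(** The negative half-line has mass zero, so absolute moments agree with moments; they supply a
    dominating function on the whole line. *)
Lemma integral_normX n : (\int[F]_x (`|x| ^+ n)%:E = (tree_moment n)%:E)%E.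
Proof.
rewrite (@ge0_negligible_integral _ _ _ F setT (~` `[0, +oo[)) //; last 3 first.
- exact: measurableC.
- apply/measurable_EFinP/measurable_funX; exact: normr_measurable.
- exact: F_setC0.
rewrite setTD setCK -F_lambda.2; apply: eq_integral => x.
by rewrite inE /= in_itv /= andbT => x0; rewrite ger0_norm.
Qed.

Lemma integrable_normX n : F.-integrable setT (fun x => (`|x| ^+ n)%:E).
Proof.
apply/integrableP; split.
  apply/measurable_EFinP/measurable_funX; exact: normr_measurable.
under eq_integral do rewrite gee0_abs ?lee_fin ?exprn_ge0 //.
by rewrite integral_normX ltry.
Qed.

Lemma Rintegral_normX n : \int[F]_x (`|x| ^+ n) = tree_moment n.
Proof. by rewrite /Rintegral integral_normX. Qed.

Lemma integrable_exprn n : F.-integrable setT (fun x => (x ^+ n)%:E).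
Proof.
apply: le_integrable (integrable_normX n) => //.
  by apply/measurable_EFinP; apply: measurable_funX.
by move=> x _; rewrite /= lee_fin normrX normrX normr_id.
Qed.

Lemma cintegrableX n : cintegrable F (fun x => x%:C ^+ n).
Proof.
split; under eq_fun do rewrite -rmorphXn /=; last exact: integrable0.
exact: integrable_exprn.
Qed.

Lemma cintegralX n : cintegral F (fun x => x%:C ^+ n) = (tree_moment n)%:C.
Proof.
under eq_fun do rewrite -rmorphXn /=.
rewrite /cintegral /= {2}/Rintegral integral0 /=; congr (_ +i* _).
rewrite -Rintegral_normX /Rintegral; congr fine.
rewrite [LHS](@negligible_integral _ _ _ F setT (~` `[0, +oo[)) //; last 3 first.
- exact: measurableC.
- exact: integrable_exprn.
- exact: F_setC0.
rewrite setTD setCK integral_normX -F_lambda.2; exact: eq_integral.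
Qed.

(** The remainder [x^n / (z^n (z - x))] is dominated by the [n]-th absolute moment together with
    [|1 / (z - x)| <= 1 / |Im z|]. *)
Lemma cauchy_expansion z n : complex.Im z != 0 ->
  `|\sum_(k < n) (tree_moment k)%:C * z ^- k.+1 - cauchy_transform F z| <=
  2 * (tree_moment n)%:C * `|z| ^- n * (`|complex.Im z|^-1)%:C.
Proof.
move=> z0; have zn0 : z != 0 by apply: contraNneq z0 => ->.
rewrite distrC cauchy_transformE.
have exp_z (x : R) : (z - x%:C)^-1 =
    \sum_(k < n) z ^- k.+1 * x%:C ^+ k + z ^- n * (x%:C ^+ n * (z - x%:C)^-1).
  rewrite [LHS](geometric_expansion n zn0) ?subr_real_neq0 //.
  congr (_ + _); last by rewrite mulrCA.
  by apply: eq_bigr => k _; rewrite mulrC.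
have mX k := cintegrableZ (z ^- k.+1) (cintegrableX k).
have [remi rem_le] : cintegrable F (fun x => x%:C ^+ n * (z - x%:C)^-1) /\
    `|cintegral F (fun x => x%:C ^+ n * (z - x%:C)^-1)| <=
    (2 * \int[F]_x (`|x| ^+ n * `|complex.Im z|^-1))%:C.
  apply: cintegral_dominated => [||x].
  - apply: cmeasurableM; last exact: cmeasurable_resolvent.
    by apply: cmeasurableX; split; [exact: measurable_id | exact: measurable_cst].
  - under eq_fun do rewrite EFinM; apply: integrableZr => //.
    exact: integrable_normX.
  - rewrite normrM normrX rmorphM rmorphXn ler_pM ?exprn_ge0 ?norm_resolvent_le //.
    by rewrite normc_def /= expr0n addr0 sqrtr_sqr.
under eq_fun do rewrite exp_z.
rewrite cintegralD; last exact: cintegrableZ.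
  rewrite (cintegral_sum _ mX) cintegralZ // addrAC.
  under eq_bigr do rewrite (cintegralZ _ (cintegrableX _)) cintegralX mulrC.
  rewrite subrr add0r normrM normfV normrX.
  rewrite (le_trans (ler_wpM2l _ rem_le)) ?invr_ge0 ?exprn_ge0 //.
  rewrite RintegralZr //; last exact: integrable_normX.
  rewrite Rintegral_normX !rmorphM rmorph_nat /=.
  by rewrite le_eqVlt; apply/orP; left; apply/eqP; ring.
exact: (cintegrable_sum _ mX).
Qed.

End Moments.

End CauchyTransform.

(** * The equation for the Cauchy transform: far from the real axis, then everywhere off it *)

Section StaircaseCauchyTransform.
Variables (R : realType) (a : seq nat) (F : probability (measurableTypeR R) R).
Hypotheses (a_gt0 : (0 < sumn a)%N) (F_lambda : is_F_lambda (staircase a) F).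
Local Notation l := ((size (staircase a))%:R : R[i]).
Local Notation G := (cauchy_transform F).
Local Notation L := (cauchy_poly (psum a) (size a) l).

Lemma size_staircase_gt0 : 0 < l.
Proof. by rewrite ltr0n size_staircase. Qed.

Lemma momentC n :
  (tree_moment R (staircase a) n)%:C = (lambda_tree_count (staircase a) n)%:R / l ^+ n.+1.
Proof. by rewrite /tree_moment rmorphM fmorphV rmorphXn /= !rmorph_nat. Qed.

(** The bound on tree counts at [rho = 1 / (4 l)]; the threshold [4] on [|Im z|] originates here. *)
Lemma moment_le n : (tree_moment R (staircase a) n)%:C <= 2 * 4 ^+ n.
Proof.
have l0 := size_staircase_gt0; have rho0 : 0 < (4 * l)^-1 by rewrite invr_gt0 mulr_gt0.
have rhoE : 4 * l * (4 * l)^-1 = 1 by rewrite mulfV // gt_eqF // mulr_gt0.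
have := @lambda_tree_count_le _ (staircase a) n _ (ltW rho0); rewrite rhoE => /(_ (lexx _)) h.
rewrite momentC ler_pdivrMr ?exprn_gt0 // exprS mulrACA (mulrC 2).
rewrite exprVn ler_pdivrMr ?exprn_gt0 ?mulr_gt0 // in h.
by rewrite -mulrA -exprMn mulrA.
Qed.

Lemma tree_poly_moment z n : z != 0 ->
  (tree_poly R[i] (staircase a) n).[(l * z)^-1] =
  \sum_(k < n) (tree_moment R (staircase a) k)%:C * z ^- k.+1.
Proof.
move=> z0; rewrite /tree_poly hornerMX horner_poly mulr_suml; apply: eq_bigr => k _.
by rewrite -mulrA -exprSr momentC exprVn exprMn invfM mulrA.
Qed.

Lemma cauchy_poly_far z : 4 < `|complex.Im z| -> L.[G z, z] = 0.
Proof.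
move=> Imz; have l0 := size_staircase_gt0.
have Imz0 : complex.Im z != 0 by rewrite -normr_gt0; apply: lt_trans Imz.
have zn4 : 4 < `|z|.
  by apply: lt_le_trans (Im_le_normc z); rewrite -(rmorph_nat (real_complex R)) ltcR.
have zp : 0 < `|z| by apply: lt_trans zn4.
have z0 : z != 0 by rewrite -normr_gt0.
rewrite cauchy_polyE ?(gt_eqF l0) //.
suff -> : (stair_poly R[i] (psum a) (size a)).[G z, (l * z)^-1] = 0 by rewrite mulr0.
have t1 : 4 / `|z| < 1 by rewrite ltr_pdivrMr // mul1r.
have t0 : 0 <= 4 / `|z| by rewrite divr_ge0.
have rho0 : 0 < (4 * l)^-1 by rewrite invr_gt0 mulr_gt0.
have Iz0 : 0 <= (`|complex.Im z|^-1)%:C by rewrite -[0]/(0%:C) lecR invr_ge0.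
(* With [x = 1 / (l z)] and radius [1 / (4 l)] the ratio is [4 / |z|], and [moment_le] shows that
   the truncations approach [G z] at that rate. *)
have [|||||||C C0 HC] := @horner2_limit_le R[i] (stair_poly R[i] (psum a) (size a))
   (tree_poly R[i] (staircase a)) (4 * l)^-1 (l * 2 * (4 * l)^-1) (l * z)^-1 (G z)
   (2 * 2 * (`|complex.Im z|^-1)%:C) (4 / `|z|) rho0.
- by rewrite !mulr_ge0 // ltW.
- by rewrite !mulr_ge0.
- rewrite normfV normrM (gtr0_norm l0) le_eqVlt; apply/orP; left; apply/eqP.
  by field; rewrite !gt_eqF.
- exact: ltW.
- move=> n; apply: tree_poly_norm_le; first exact: ltW.
  by rewrite mulfV // gt_eqF // mulr_gt0.
- by move=> n; apply: stair_poly_tree_dvd.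
- move=> n; rewrite tree_poly_moment //.
  apply: le_trans (cauchy_expansion F_lambda n Imz0) _.
  rewrite [leRHS]mulrAC ler_wpM2r // exprMn exprVn mulrA ler_wpM2r //.
  by rewrite -mulrA ler_wpM2l // moment_le.
by apply: (@eq0_geometric _ _ C (4 / `|z|)); rewrite ?t0.
Qed.

Lemma cauchy_poly_root z : z \isn't Num.real -> L.[G z, z] = 0.
Proof.
move=> /Im_neq0 Imz0; set y := complex.Im z in Imz0.
have y0 : 0 < `|y| by rewrite normr_gt0.
(* The centre [w] lies [4] further from the real axis than [z], on the same side. *)
pose s : R[i] := 0 +i* (- (4 * Num.sg y)); pose w := z - s.
have zE : z = w + s by rewrite subrK.
have ns : `|s| = 4.
  rewrite normc_def /= expr0n add0r sqrrN sqrtr_sqr normrM normr_sg Imz0 mulr1.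
  by rewrite normr_nat (rmorph_nat (real_complex R)).
have Iw : `|complex.Im w| = 4 + `|y|.
  rewrite raddfB /= opprK -/y {1}[y]numEsg [4 * _]mulrC -mulrDr normrM normr_sg Imz0 mul1r.
  by rewrite ger0_norm 1?addrC // addr_ge0.
(* Any radius strictly between [|s| = 4] and [|Im w| = 4 + |y|] would do; this is the midpoint. *)
pose rho : R[i] := (4 + `|y| / 2)%:C.
have rho4 : 4 < rho.
  by rewrite -(rmorph_nat (real_complex R)) ltcR ltrDl divr_gt0.
have rho0 : 0 < rho by apply: lt_trans rho4.
have rhow : rho < `|complex.Im w|%:C.
  by rewrite Iw ltcR; lra.
have w0 : complex.Im w != 0 by rewrite -normr_gt0 Iw addr_gt0.
pose M := 2 * (`|complex.Im w|^-1)%:C * (1 - rho * (`|complex.Im w|^-1)%:C)^-1.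
have PM n : poly_norm rho (taylor_poly F w n) <= M.
  by apply: taylor_poly_norm_le; rewrite ltW.
have M0 : 0 <= M by apply: le_trans (PM 0%N); rewrite poly_norm_ge0 // ltW.
(* The equation recentred at [w], its inner variable being the displacement from [w]. *)
pose Lw := map_poly (comp_poly ('X + w%:P)) L.
have LwE u x : Lw.[u, x] = L.[u, w + x].
  rewrite /Lw; elim/poly_ind: (L) => [|p c IH]; first by rewrite raddf0 !horner0.
  rewrite rmorphD rmorphM /= map_polyX map_polyC /= !hornerE IH.
  by rewrite horner_comp hornerD hornerX hornerC (addrC w).
(* In [R[i]], [0 <= x] forces [x] to be real, so [w + x] has the imaginary part of [w] and stays in
   the far region. *)
have far x : 0 <= x -> Lw.[G (w + x), x] = 0.
  move=> /ger0_Im x0; rewrite LwE; apply: cauchy_poly_far.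
  by rewrite raddfD /= x0 addr0 Iw ltrDl.
have nIw : 0 <= (`|complex.Im w|^-1)%:C by rewrite -[0]/(0%:C) lecR invr_ge0.
(* For [x] in [(0, 1]] the Taylor truncation is within [O(x^n)] of [G (w + x)], where [Lw] vanishes;
   the Lipschitz bound carries this over to its value. *)
have dvd n : 'X^n %| Lw.[taylor_poly F w n].
  pose B := 2 * (`|complex.Im w|^-1)%:C.
  have B0 : 0 <= B by rewrite mulr_ge0.
  have [C C0 HC] := horner2_lipschitz Lw (ltW rho0) (addr_ge0 M0 B0).
  apply: (@dvdXn_norm_le _ _ (C * (B * (`|complex.Im w|^-1)%:C ^+ n))).
    by rewrite !mulr_ge0 ?exprn_ge0.
  move=> x /andP[x0 x1]; have Ix := ger0_Im (ltW x0).
  have Iwx : complex.Im (w + x) = complex.Im w by rewrite raddfD /= Ix addr0.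
  have xrho : `|x| <= rho.
    by rewrite gtr0_norm // (le_trans x1) // (le_trans _ (ltW rho4)) // ler1n.
  rewrite horner2_horner -[X in `|X|]subr0 -(far x (ltW x0)).
  apply: le_trans (HC _ _ _ xrho _ _) _.
  - by rewrite (le_trans (norm_horner_le _ xrho)) // (le_trans (PM n)) // lerDl.
  - rewrite (le_trans (norm_cauchy_transform_le _ _)) ?Iwx //.
    by rewrite lerDr.
  rewrite -mulrA ler_wpM2l //.
  apply: le_trans (cauchy_taylor F n w0 _) _; rewrite Iwx //.
  by rewrite exprMn (gtr0_norm x0) -/B [x ^+ n * _]mulrC mulrA.
rewrite zE -LwE.
have t1 : 4 / rho < 1 by rewrite ltr_pdivrMr // mul1r.
have t0 : 0 <= 4 / rho by rewrite divr_ge0 // ltW.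
have nIz : 0 <= (`|complex.Im z|^-1)%:C by rewrite -[0]/(0%:C) lecR invr_ge0.
(* The ratio is now [|s| / rho = 4 / rho]; since [rho < |Im w|], the Taylor error, of order
   [(4 / |Im w|)^n], decays at least as fast. *)
have [||||||C C0 HC] := @horner2_limit_le R[i] Lw (taylor_poly F w) rho M s (G (w + s))
  (2 * (`|complex.Im z|^-1)%:C) (4 / rho) rho0 M0.
- by rewrite mulr_ge0.
- by rewrite ns mulfVK // gt_eqF.
- exact: ltW.
- exact: PM.
- exact: dvd.
- move=> n; rewrite zE; apply: le_trans (cauchy_taylor F n w0 _) _; first by rewrite -zE.
  have sw : `|s| * (`|complex.Im w|^-1)%:C <= 4 / rho.
    rewrite ns ler_wpM2l // fmorphV lef_pV2 ?posrE ?(lt_trans rho0 rhow) //.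
    exact: ltW.
  by rewrite -zE ler_wpM2l ?mulr_ge0 // lerXn2r ?nnegrE ?t0 ?mulr_ge0.
by apply: (@eq0_geometric _ _ C (4 / rho)); rewrite ?t0.
Qed.

End StaircaseCauchyTransform.

Unset Implicit Arguments.

Theorem theorem5p3 (R : realType) (r : nat) (a : r.-tuple nat)
  (r_ge1 : (1 <= r)%N) (a_gt0 : forall i : 'I_r, (0 < tnth a i)%N)
  (F : probability (measurableTypeR R) R)
  (F_lambda : is_F_lambda (staircase a) F) :
  exists L : {poly {poly R[i]}},
    [/\ size L = r.+2,
        sizeY L = r.+1
      & forall z : R[i], z \isn't Num.real ->
          L.[cauchy_transform F z, z] = 0].
Proof.
have sum_gt0 : (0 < sumn a)%N.
  case: r r_ge1 a a_gt0 {F_lambda} => // r _ a a_gt0.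
  by rewrite (tuple_eta a) /= ltn_addr //; apply: (a_gt0 ord0).
exists (cauchy_poly (psum a) (size a) (size (staircase a))%:R); split.
- by rewrite size_cauchy_poly size_tuple.
- by rewrite sizeY_cauchy_poly size_tuple.
- by move=> z; exact: cauchy_poly_root.
Qed.
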